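(* Let $G$ be a finite group and let $\delta > 0$ be an integer with $\Delta(G) = \delta$. Then $|G| \le 8\delta$. Moreover, equality $|G| = 8\delta$ occurs only when $\delta = 2^k$ for some integer $k \ge 0$, and in that case (that is, when $|G| = 8\delta$ with $\delta = 2^k$) one has $G \cong D_8 \times C_2^k$.
   Context: For a finite group $G$, let $C(G)$ denote the set (poset under inclusion) of all cyclic subgroups of $G$, including the trivial subgroup, and define $\Delta(G) = |G| - |C(G)|$, the difference between the order of $G$ and the number of its cyclic subgroups. $C_n$ denotes the cyclic group of order $n$, $C_2^k$ denotes the direct product of $k$ copies of $C_2$ (trivial if $k=0$), and $D_{2n}$ denotes the dihedral group of order $2n$, so $D_8$ is the dihedral group of order $8$. *)

(* Defs.v *)
From mathcomp Require Import all_boot all_fingroup all_algebra all_solvable.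

Set Implicit Arguments.
Unset Strict Implicit.
Unset Printing Implicit Defensive.

Import GroupScope.

Definition cyclic_subgroups (gT : finGroupType) (G : {group gT}) :
    {set {group gT}} :=
  [set H in subgroups G | cyclic H].

(* The subtraction is truncated, but harmlessly so: see                       *)
(* leq_card_cyclic_subgroups.                                                 *)
Definition Delta (gT : finGroupType) (G : {group gT}) : nat :=
  #|G| - #|cyclic_subgroups G|.

Lemma leq_card_cyclic_subgroups (gT : finGroupType) (G : {group gT}) :
  #|cyclic_subgroups G| <= #|G|.
Proof.
apply: leq_trans (leq_imset_card (fun x => <[x]>%G) G).
apply/subset_leq_card/subsetP=> H; rewrite !inE => /andP[sHG /cyclicP[x defH]].
apply/imsetP; exists x; last exact/val_inj.
by rewrite (subsetP sHG) // defH cycle_id.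
Qed.

(* The library equips {dffun ...}, and not {ffun ...}, with the external      *)
(* direct product structure; 'Z_2 carries its additive group structure.       *)
Definition C2pow (k : nat) : finGroupType := {dffun 'I_k -> 'Z_2}.

(* Main.v *)
Require Import Defs.
From mathcomp Require Import all_boot all_fingroup all_algebra all_solvable.
From mathcomp Require Import zify.

(** Let S be the set of solutions of x * x = 1 in G.  A cyclic subgroup
    <[x]> is also generated by x^-1, so it either has at least two generators or
    has a generator in S.  Counting the elements of G and of S by the cyclic
    subgroup they generate gives
      2 #|C(G)| <= #|G| + #|S|   ([cyclic_subgroups_count]),
    that is, #|G| - #|S| <= 2 delta.  Since delta > 0, S is not all of G
    ([Delta_sqrt1]), and everything follows from the classical fact that
    #|S| <= 3/4 #|G| when S != G, with equality only for D_8 x C_2^k.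

    To see this fact ([D8_dprod_of_large_sqrt1]), suppose S != G and
    #|S| >= 3/4 #|G|.  If x, y and x y all lie in S, then x and y commute;
    hence S :&: x S is contained in 'C_G[x] for x in S, while it has at least
    2 #|S| - #|G| >= #|G| / 2 elements.  Some x in S is not central,
    as otherwise S would be a subgroup of index less than 2; for this x the
    centraliser A is proper, so it has index exactly 2 and is equal to
    S :&: x S.  Thus #|S| = 3/4 #|G|, and A, a group of elements of square 1,
    is elementary abelian.

    Half of the coset G :\: A lies in S.  Fix b there; an element a b of
    the coset has square 1 exactly when b centralises a, so Z = 'C_A[b] has
    index 2 in A.  The commutator z = [~ x, b] is a nontrivial element of Z, so
    x and b generate a dihedral group D of order 8, and a complement K of <[z]>
    in Z gives G = D \x K with K elementary abelian. *)

Set Implicit Arguments.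
Unset Strict Implicit.
Unset Printing Implicit Defensive.

(** * Elementary abelian 2-groups *)

Section ElementaryAbelian.
Local Open Scope group_scope.

Lemma abelem2_sqr1 (gT : finGroupType) (G : {group gT}) :
  (forall x, x \in G -> x * x = 1) -> 2.-abelem G.
Proof.
move=> sqG1; have invG x: x \in G -> x^-1 = x.
  by move=> /sqG1 /(canRL (mulKg x)); rewrite mulg1.
rewrite abelemE //; apply/andP; split; last first.
  by apply/exponentP=> x Gx; rewrite expgS expg1 sqG1.
apply/centsP=> x Gx y Gy; rewrite /commute.
by rewrite -(invG (x * y)) ?groupM // invMg !invG.
Qed.

Lemma abelem_C2pow (k : nat) : 2.-abelem [set: C2pow k].
Proof.
apply: abelem2_sqr1 => x _; apply/ffunP=> i.
by rewrite ffunE [RHS]ffunE; case: (x i) => [[|[|//]]] ?; apply: val_inj.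
Qed.

Lemma card_C2pow (k : nat) : #|[set: C2pow k]| = (2 ^ k)%N.
Proof. by rewrite cardsT card_ffun !card_ord. Qed.

Lemma isog_C2pow (gT : finGroupType) (K : {group gT}) :
  2.-abelem K -> K \isog [set: C2pow (logn 2 #|K|)].
Proof.
move=> abK; rewrite (isog_abelem_card _ abK) abelem_C2pow card_C2pow eq_sym.
exact/eqP/card_pgroup/abelem_pgroup.
Qed.

End ElementaryAbelian.

(** * Elements of square 1 *)

Section Squares.
Local Open Scope group_scope.
Variable gT : finGroupType.
Implicit Types G H A : {group gT}.

Definition sqrt1 (G : {group gT}) := [set x in G | x * x == 1].

Lemma sqrt1P G x :
  reflect (x \in G /\ x * x = 1) (x \in sqrt1 G).
Proof. by rewrite inE; apply: (iffP andP) => -[-> /eqP]. Qed.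

Lemma sqrt1_inv G x : x \in sqrt1 G -> x^-1 = x.
Proof. by move=> /sqrt1P[_ /(canRL (mulKg x))]; rewrite mulg1. Qed.

Lemma sqrt1_sub G : sqrt1 G \subset G.
Proof. by apply/subsetP=> x /sqrt1P[]. Qed.

(** Each cyclic subgroup <[x]> is counted at least twice on the right-hand side:
    through x and x^-1 if these differ, and otherwise through x as an element of
    G and again as an element of [sqrt1 G]. *)
Lemma cyclic_subgroups_count G :
  (2 * #|cyclic_subgroups G| <= #|G| + #|sqrt1 G|)%N.
Proof.
pose gen x : {group gT} := <[x]>%G.
have genG x : x \in G -> gen x \in cyclic_subgroups G.
  by move=> Gx; rewrite !inE cycle_subG Gx cycle_cyclic.
rewrite -!sum1_card (partition_big gen (mem (cyclic_subgroups G))) //=.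
rewrite [X in _ + X](partition_big gen (mem (cyclic_subgroups G))) /=; last first.
  by move=> x /sqrt1P[Gx _]; apply: genG.
rewrite -big_split big_distrr /=; apply: leq_sum => H.
rewrite !inE => /andP[sHG /cyclicP[x defH]].
have eHx : H = gen x by apply: val_inj.
have Gx : x \in G by rewrite (subsetP sHG) // defH cycle_id.
have geninv : gen x^-1 = gen x by apply: val_inj; rewrite /= cycleV.
rewrite (bigD1 x) /= ?Gx ?eHx ?eqxx //.
have [sq1 | sq1] := boolP (x \in sqrt1 G).
  rewrite [X in (_ + X)%N](bigD1 x) /= ?sq1 ?eqxx //; lia.
rewrite (bigD1 x^-1) /= ?groupV ?Gx ?geninv ?eqxx //=.
apply: contraNneq sq1 => e; apply/sqrt1P; split=> //.
by rewrite -{1}e mulVg.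
Qed.

(** An element of square 1 is determined by the cyclic group it generates, so
    there are then as many cyclic subgroups as elements. *)
Lemma Delta_sqrt1 G : sqrt1 G = G -> Delta G = 0%N.
Proof.
move=> eSG; apply/eqP; rewrite subn_eq0.
pose gen x : {group gT} := <[x]>%G.
rewrite -(@card_in_imset _ _ gen G) => [|x y].
  apply/subset_leq_card/subsetP=> _ /imsetP[x Gx ->].
  by rewrite !inE cycle_subG Gx cycle_cyclic.
have sqrt1_gen z t : z \in sqrt1 G -> t \in <[z]> -> t = 1 \/ t = z.
  move=> /sqrt1P[_ zz] /cycleP[n ->]; elim: n => [|n [|]]; first by left.
    by move=> e; right; rewrite expgS e mulg1.
  by move=> e; left; rewrite expgS e zz.
rewrite -eSG => Sx Sy /(congr1 val) /= eC.
have: x \in <[y]> by rewrite -eC cycle_id.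
case/(sqrt1_gen _ _ Sy)=> // x1; have: y \in <[x]> by rewrite eC cycle_id.
by case/(sqrt1_gen _ _ Sx)=> // ->; rewrite x1.
Qed.

(** If x, y and x * y are all equal to their inverses, then
    x * y = (x * y)^-1 = y^-1 * x^-1 = y * x. *)
Lemma sqrt1_lcoset_cent G x :
  x \in sqrt1 G -> sqrt1 G :&: x *: sqrt1 G \subset 'C_G[x].
Proof.
move=> Sx; apply/subsetP=> xy /setIP[Sxy /lcosetP[y Sy exy]].
rewrite inE (subsetP (sqrt1_sub G)) //; apply/cent1P.
have := sqrt1_inv Sxy; rewrite exy invMg (sqrt1_inv Sx) (sqrt1_inv Sy) => cyx.
by rewrite /commute -mulgA cyx.
Qed.

Lemma proper_card_double A G : A \proper G -> (2 * #|A| <= #|G|)%N.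
Proof.
case/andP=> sAG nsGA; rewrite -(Lagrange sAG) mulnC leq_mul2l.
by rewrite indexg_gt1 nsGA orbT.
Qed.

(** Subgroups of index 2 are maximal; here y witnesses that A is proper in H. *)
Lemma index2_sub_eq A H G y :
  A \subset H -> H \subset G -> #|G| = (2 * #|A|)%N ->
  y \in H -> y \notin A -> H :=: G.
Proof.
move=> sAH sHG cG Hy nAy; apply/eqP; rewrite eqEcard sHG cG.
apply: proper_card_double; rewrite properE sAH /=.
by apply: contra nAy => /subsetP/(_ _ Hy).
Qed.

(** If [sqrt1 G] were central it would be closed under products, hence a
    subgroup, and a proper subgroup has at most half the elements of G. *)
Lemma sqrt1_noncentral G :
  sqrt1 G != G -> (3 * #|G| <= 4 * #|sqrt1 G|)%N ->
  exists2 x, x \in sqrt1 G & ~~ (G \subset 'C[x]).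
Proof.
move=> nSG big; apply/exists_inP; apply: contraNT nSG.
rewrite negb_exists_in => /forall_inP central.
have gS : group_set (sqrt1 G).
  apply/group_setP; split=> [|x y Sx Sy].
    by apply/sqrt1P; rewrite group1 mulg1.
  have [/sqrt1P[Gx xx] /sqrt1P[Gy yy]] := (Sx, Sy).
  have /negbNE/subsetP/(_ _ Gy)/cent1P cxy := central x Sx.
  apply/sqrt1P; rewrite groupM //; split=> //.
  by rewrite -mulgA [y * (x * y)]mulgA cxy -!mulgA yy mulg1.
have := sqrt1_sub G; rewrite eqEproper => -> /=.
apply/negP=> pSG.
have le2 : (2 * #|sqrt1 G| <= #|G|)%N := @proper_card_double (group gS) G pSG.
by have := cardG_gt0 G; lia.
Qed.

(** Inclusion-exclusion gives [sqrt1 G :&: x *: sqrt1 G] at least #|G| / 2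
    elements, and it sits inside the proper subgroup 'C_G[x], which has at most
    that many: all the inequalities are equalities. *)
Lemma sqrt1_lcoset_eq_cent G x :
  x \in sqrt1 G -> ~~ (G \subset 'C[x]) -> (3 * #|G| <= 4 * #|sqrt1 G|)%N ->
  [/\ 'C_G[x] \subset sqrt1 G, #|G| = (2 * #|'C_G[x]|)%N
    & (4 * #|sqrt1 G| = 3 * #|G|)%N].
Proof.
move=> Sx ncx big; have sIC := sqrt1_lcoset_cent Sx.
have pC : 'C_G[x] \proper G.
  by rewrite properEneq subsetIl andbT; apply: contraNneq ncx => <-; apply: subsetIr.
have cC : (2 * #|'C_G[x]| <= #|G|)%N := proper_card_double pC.
have cIC : (#|sqrt1 G :&: x *: sqrt1 G| <= #|'C_G[x]|)%N := subset_leq_card sIC.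
have cU : (#|sqrt1 G :|: x *: sqrt1 G| <= #|G|)%N.
  have [Gx _] := sqrt1P _ _ Sx.
  apply: subset_leq_card; rewrite subUset sqrt1_sub /=.
  by apply: subset_trans (mulgS [set x] (sqrt1_sub G)) _; rewrite lcoset_id.
have cUI : (#|sqrt1 G :|: x *: sqrt1 G| + #|sqrt1 G :&: x *: sqrt1 G|
            = #|sqrt1 G| + #|sqrt1 G|)%N.
  by rewrite cardsUI card_lcoset.
have le_CI : (#|'C_G[x]| <= #|sqrt1 G :&: x *: sqrt1 G|)%N by lia.
split; [|lia|lia].
have /eqP <- : sqrt1 G :&: x *: sqrt1 G == 'C_G[x] by rewrite eqEcard sIC.
exact: subsetIl.
Qed.

(** The elements of G outside A are the products a * b with a in A; since a and b
    are their own inverses, a * b has square 1 only if a and b commute. *)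
Lemma sqrt1_coset_cent G A b :
  A \subset G -> #|G : A| = 2 -> A \subset sqrt1 G -> b \in sqrt1 G :\: A ->
  sqrt1 G :\: A \subset 'C_A[b] :* b.
Proof.
move=> sAG iA sAS /setDP[Sb nAb]; have [Gb _] := sqrt1P _ _ Sb.
have eAb : A :* b = G :\: A by apply: rcoset_index2; rewrite // in_setD Gb nAb.
apply/subsetP=> s /setDP[Ss nAs].
have [|a Aa eab] := rcosetP (_ : s \in A :* b).
  by rewrite eAb in_setD nAs (subsetP (sqrt1_sub G)).
rewrite eab mem_rcoset mulgK in_setI Aa; apply/cent1P; rewrite /commute.
have := sqrt1_inv Ss; rewrite eab invMg (sqrt1_inv Sb) => <-.
by rewrite (sqrt1_inv (subsetP sAS a Aa)).
Qed.

(** Two involutions generate a dihedral group; its order is 8 because <[b]>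
    normalises <[x * b]> and meets it trivially.  Indeed, if b were in that
    cyclic group it would commute with x, and x * b would have order at most 2. *)
Lemma involutions_gen_D8 (D : {group gT}) x b :
  <<[set x; b]>> = D ->
  #[x] = 2 -> #[b] = 2 -> #[x * b] = 4 ->
  #|D| = 8 /\ D \isog [set: 'D_8].
Proof.
move=> defD ox ob oxb.
have sq1 (t : gT) : #[t] = 2 -> t * t = 1 by move=> ot; rewrite -(expg_order t) ot.
have [xx bb] := (sq1 x ox, sq1 b ob).
have xV : x^-1 = x by apply/eqP; rewrite eq_invg_mul xx.
have bV : b^-1 = b by apply/eqP; rewrite eq_invg_mul bb.
(* Conjugation by b inverts x * b. *)
have nb : <[b]> \subset 'N(<[x * b]>).
  rewrite norms_cycle conjgE bV -!mulgA bb mulg1.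
  by rewrite -{1}bV -{1}xV -invMg groupV cycle_id.
have eD : D :=: <[x * b]> * <[b]>.
  rewrite -norm_joinEr // -defD; set J := _ <*> _.
  have Jxb : x * b \in J by apply: (subsetP (joing_subl _ _)); apply: cycle_id.
  have Jb : b \in J by apply: (subsetP (joing_subr _ _)); apply: cycle_id.
  apply/eqP; rewrite eqEsubset; apply/andP; split.
    by rewrite gen_subG subUset !sub1set Jb andbT -(groupMr x Jb).
  by rewrite join_subG !cycle_subG groupM ?mem_gen ?set21 ?set22.
have tb : <[b]> :&: <[x * b]> = 1.
  apply: prime_TIg; first by rewrite -orderE ob.
  rewrite cycle_subG; apply/negP=> Cb.
  have cxb : commute (x * b) b.
    by apply: (centsP (cycle_abelian (x * b))); rewrite ?cycle_id.
  have: #[x * b] %| 2.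
    by rewrite order_dvdn expgS expg1 -mulgA -cxb -mulgA bb mulg1 xx.
  by rewrite oxb.
have cD : #|D| = 8.
  by rewrite eD TI_cardMg 1?setIC // -!orderE oxb ob.
split=> //; rewrite -cD -defD; apply: involutions_gen_dihedral => //.
by apply: contra_eqN oxb => /eqP->; rewrite bb order1.
Qed.

(** The factor D is generated by x and b, whose commutator z is an involution of
    Z = 'C_A[b]; K is a complement of <[z]> in Z, which exists because Z is
    elementary abelian.  The subgroup D * K contains Z, x and b, so it is all of G
    by maximality of Z in A and of A in G; comparing orders then gives
    D :&: K = 1. *)
Lemma D8_dprod_abelem G A (Z : {group gT}) x b :
  2.-abelem A -> #|G| = (2 * #|A|)%N -> #|A| = (2 * #|Z|)%N -> A <| G ->
  'C_A[b] = Z -> x \in A :\: Z -> b \in G :\: A -> b * b = 1 ->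
  exists D K : {group gT},
    [/\ D \x K = G, D \isog [set: 'D_8], 2.-abelem K & #|G| = (8 * #|K|)%N].
Proof.
move=> abA cG cA nAG defZ /setDP[Ax nZx] /setDP[Gb nAb] bb.
have sAG := normal_sub nAG; have Gx := subsetP sAG x Ax.
have sZA : Z \subset A by rewrite -defZ subsetIl.
have sqA a : a \in A -> a * a = 1.
  by case/abelemP: abA => // _ /[apply]; rewrite expgS expg1.
have bV : b^-1 = b by apply/eqP; rewrite eq_invg_mul bb.
have invA a : a \in A -> a^-1 = a.
  by move=> Aa; apply/eqP; rewrite eq_invg_mul sqA.
have o2 (t : gT) : t * t = 1 -> t != 1 -> #[t] = 2.
  by move=> tt tn1; apply: nt_prime_order => //; rewrite expgS expg1.
pose z := [~ x, b].
have ez : z = x * b * x * b by rewrite /z commgEl conjgE bV (invA x) // !mulgA.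
have zn1 : z != 1.
  apply: contra nZx => /commgP cxb; rewrite -defZ in_setI Ax.
  exact/cent1P/commute_sym.
have Az : z \in A.
  rewrite /z commgEl groupMl ?groupV // memJ_norm //.
  exact: (subsetP (normal_norm nAG)).
have oz : #[z] = 2 by apply: o2; rewrite ?sqA.
have Zz : z \in Z.
  rewrite -defZ in_setI Az; apply/cent1P; rewrite /commute.
  by rewrite -{1}(invA z) // ez !invMg (invA x) // bV !mulgA.
have abZ : 2.-abelem Z := abelemS sZA abA.
have sz : <[z]> \subset Z by rewrite cycle_subG.
have /splitsP[K /complP[tzK ezK]] := abelem_splits abZ sz.
have cK : #|Z| = (2 * #|K|)%N by rewrite -ezK TI_cardMg // -orderE oz.
have sKZ : K \subset Z by rewrite -ezK mulG_subr.
have sKA := subset_trans sKZ sZA.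
have [D defD] : exists D : {group gT}, <<[set x; b]>> = D by eexists.
have ox : #[x] = 2 by apply: o2; rewrite ?sqA //; apply: contraNneq nZx => ->.
have ob : #[b] = 2 by apply: o2; rewrite //; apply: contraNneq nAb => ->.
(* z = (x * b) ^+ 2 has order 2. *)
have oxb : #[x * b] = 4.
  by apply: (@orderXprime _ 2 2); rewrite // expgS expg1 mulgA -ez.
have [cD isoD] := involutions_gen_D8 defD ox ob oxb.
have Dx : x \in D by rewrite -defD mem_gen // set21.
have Db : b \in D by rewrite -defD mem_gen // set22.
have cKD : K \subset 'C(D).
  rewrite centsC -defD gen_subG subUset !sub1set; apply/andP; split.
    by apply: (subsetP (centS sKA)); apply: (subsetP (abelem_abelian abA)).
  rewrite -sub_cent1; apply: subset_trans sKZ _.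
  by rewrite -defZ subsetIr.
have sDG : D \subset G by rewrite -defD gen_subG subUset !sub1set Gx.
have eDK : D * K = G.
  rewrite -cent_joinEr //; have [M defM] : exists M : {group gT}, D <*> K = M.
    by eexists.
  have sDM : D \subset M by rewrite -defM joing_subl.
  have sMG : M \subset G by rewrite -defM join_subG sDG (subset_trans sKA).
  have [Mx Mb] : x \in M /\ b \in M by rewrite !(subsetP sDM).
  have sZM : Z \subset M.
    by rewrite -ezK mul_subG -?defM ?joing_subr // defM cycle_subG groupR.
  have eA : (M :&: A)%G :=: A.
    apply: (index2_sub_eq _ _ cA _ nZx); rewrite ?in_setI ?Mx //=.
      by rewrite subsetI sZM.
    exact: subsetIr.
  by rewrite defM; apply: (index2_sub_eq _ sMG cG Mb nAb); rewrite -eA subsetIl.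
have cGK : #|G| = (8 * #|K|)%N by rewrite cG cA cK !mulnA.
have tDK : D :&: K = 1.
  apply: card1_trivg; apply/eqP; rewrite -(eqn_pmul2l (cardG_gt0 G)) muln1.
  by rewrite -{1}eDK -mul_cardG cD cGK.
by exists D, K; split; rewrite ?dprodE // (abelemS sKZ).
Qed.

(** With x a noncentral element of [sqrt1 G] and A its centraliser, the equality
    #|sqrt1 G| = 3/4 #|G| leaves half of the coset [G :\: A] to [sqrt1 G], and
    these elements all lie in 'C_A[b] :* b.  So 'C_A[b] has at least half the
    elements of A, and it is proper since b does not commute with x. *)
Lemma D8_dprod_of_large_sqrt1 G :
  sqrt1 G != G -> (3 * #|G| <= 4 * #|sqrt1 G|)%N ->
  (4 * #|sqrt1 G| = 3 * #|G|)%N /\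
  exists D K : {group gT},
    [/\ D \x K = G, D \isog [set: 'D_8], 2.-abelem K & #|G| = (8 * #|K|)%N].
Proof.
move=> nSG big; have [x Sx ncx] := sqrt1_noncentral nSG big.
have [A defA] : exists A : {group gT}, 'C_G[x] = A by eexists.
have [] := sqrt1_lcoset_eq_cent Sx ncx big.
rewrite defA => sAS cG cS; split=> //.
have [Gx _] := sqrt1P _ _ Sx.
have sAG : A \subset G by rewrite -defA subsetIl.
have abA : 2.-abelem A.
  by apply: abelem2_sqr1 => a /(subsetP sAS)/sqrt1P[].
have iA : #|G : A| = 2 by rewrite -divgS // cG mulnK ?cardG_gt0.
have cA0 : (0 < #|A|)%N := cardG_gt0 A.
have cSA : (#|A| = 2 * #|sqrt1 G :\: A|)%N.
  have cI : #|sqrt1 G :&: A| = #|A| by rewrite (setIidPr sAS).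
  have cID : (#|sqrt1 G :&: A| + #|sqrt1 G :\: A| = #|sqrt1 G|)%N := cardsID _ _.
  by lia.
have [b SAb] : exists b, b \in sqrt1 G :\: A.
  have : (0 < #|sqrt1 G :\: A|)%N by lia.
  by rewrite card_gt0 => /set0Pn.
have [/sqrt1P[Gb bb] nAb] := setDP SAb.
have Ax : x \in A by rewrite -defA in_setI Gx cent1id.
have [Z defZ] : exists Z : {group gT}, 'C_A[b] = Z by eexists.
have nZx : x \notin Z.
  apply: contra nAb; rewrite -defZ in_setI => /andP[_ Cbx].
  by rewrite -defA in_setI Gb cent1C.
have cSZ : (#|sqrt1 G :\: A| <= #|Z|)%N.
  rewrite -(card_rcoset Z b) -defZ.
  exact: subset_leq_card (sqrt1_coset_cent sAG iA sAS SAb).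
have pZA : Z \proper A.
  by rewrite properE -{1}defZ subsetIl; apply/subsetPn; exists x.
have cZ2 : (2 * #|Z| <= #|A|)%N := proper_card_double pZA.
apply: (@D8_dprod_abelem G A Z x b); rewrite ?in_setD ?nZx ?nAb //.
  by lia.
exact: index2_normal.
Qed.

End Squares.

Lemma isog_D8_C2pow (gT : finGroupType) (G D K : {group gT}) :
  (D \x K)%g = G -> D \isog [set: 'D_8] -> (2.-abelem K)%g ->
  G \isog [set: 'D_8 * C2pow (logn 2 #|K|)].
Proof.
move=> defG isoD abK.
have eXT : setX [set: 'D_8] [set: C2pow (logn 2 #|K|)]
           = [set: 'D_8 * C2pow (logn 2 #|K|)].
  by apply/setP=> t; rewrite !inE.
have := setX_dprod [set: 'D_8]%G [set: C2pow (logn 2 #|K|)]%G.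
rewrite /= eXT => defX.
apply: (isog_dprod defG (L := [set: 'D_8 * C2pow (logn 2 #|K|)]%G) defX).
  exact: isog_trans isoD (isog_setX1 _ _).
exact: isog_trans (isog_C2pow abK) (isog_set1X _ _).
Qed.

Theorem theorem2 (gT : finGroupType) (G : {group gT}) (delta : nat)
    (delta_gt0 : 0 < delta) (DeltaG : Delta G = delta) :
  #|G| <= 8 * delta
  /\ (#|G| = 8 * delta ->
      exists k : nat,
        delta = 2 ^ k /\ G \isog [set: 'D_8 * C2pow k]).
Proof.
have nS : sqrt1 G != G.
  apply/eqP=> eS; by move: delta_gt0; rewrite -DeltaG (Delta_sqrt1 eS).
have cyc := cyclic_subgroups_count G.
have eD : #|G| = delta + #|cyclic_subgroups G|.
  by rewrite -DeltaG subnK ?leq_card_cyclic_subgroups.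
have large : 8 * delta <= #|G| -> 3 * #|G| <= 4 * #|sqrt1 G| by lia.
split.
  rewrite leqNgt; apply/negP=> lt.
  have [eS _] := D8_dprod_of_large_sqrt1 nS (large (ltnW lt)).
  by lia.
move=> eG; have [|_ [D [K [defG isoD abK cG]]]] := D8_dprod_of_large_sqrt1 nS.
  by apply: large; rewrite eG.
exists (logn 2 #|K|); split; last exact: isog_D8_C2pow defG isoD abK.
rewrite -(card_pgroup (abelem_pgroup abK)).
by apply/eqP; rewrite -(eqn_pmul2l (isT : 0 < 8)) -eG cG.
Qed.
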